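(* Let $\Gamma = (I,(A_i)_{i\in I},(u_i)_{i\in I})$ be a game in normal form, and let $\mathcal{E}^n$ and $\mathcal{E}^u$ be the classes of all nested and of all universal elimination sequences of $\Gamma$, respectively. The following statements are equivalent: 1) the class of nested elimination sequences $\mathcal{E}^n$ is completely bounded; 2) the class of universal elimination sequences $\mathcal{E}^u$ is completely bounded; 3) $\mathcal{E}^n = \mathcal{E}^u$.
   Context: Game. $I$ is a set of players with at least two elements (otherwise of arbitrary cardinality); each $A_i$ is a non-empty set (of arbitrary cardinality) of pure strategies; $A=\prod_{j\in I}A_j$; $u_i:A\to\mathbb{R}$ is player $i$'s payoff function. No topological or measurability assumptions are made. Reductions. A reduction is a subset $R\subseteq A$ of the form $R=\prod_{i\in I}R_i$ with $R_i\subseteq A_i$ (possibly empty). Write $R_{-i}=\prod_{j\neq i}R_j$. Reductions are compared as subsets of $A$. For non-empty $R$ the factors $R_i$ are uniquely determined; all products with an empty factor are the same reduction $\emptyset$, and a relation $R\to\emptyset$ below is understood to hold if it holds for some choice of factors representing $\emptyset$. Strict dominance. For non-empty $R_{-i}$ and $a_i,b_i\in A_i$, write $a_i\prec_{R_{-i}}b_i$ ($a_i$ is strictly dominated by $b_i$ relative to $R_{-i}$) if $u_i(a_i,a_{-i})<u_i(b_i,a_{-i})$ for all $a_{-i}\in R_{-i}$. Dominance is defined only relative to non-empty $R_{-i}$; hence conditions about dominance impose nothing when $R=\emptyset$. For reductions $R,S$: - $R\xrightarrow{n}S$ ($S$ is a nested reduction of $R$) if $S\subseteq R$ and for all $i\in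 I$: if $a_i\in R_i\setminus S_i$, then there is $b_i\in R_i$ with $a_i\prec_{R_{-i}}b_i$. - $R\xrightarrow{u}S$ ($S$ is a universal reduction of $R$) if $S\subseteq R$ and for all $i\in I$: if $a_i\in R_i\setminus S_i$, then there is $b_i\in A_i$ with $a_i\prec_{R_{-i}}b_i$. Elimination sequences. For $\ell\in\{n,u\}$, an elimination sequence of type $\ell$ (nested if $\ell=n$, universal if $\ell=u$) is an ordinal-indexed sequence of reductions $\langle R^\alpha:\alpha<\delta\rangle$, with $\delta$ any non-zero ordinal, such that: $R^0=A$; $R^\alpha\xrightarrow{\ell}R^{\alpha+1}$ whenever $\alpha+1<\delta$; $R^\lambda=\bigcap_{\alpha<\lambda}R^\alpha$ for all limit ordinals $\lambda<\delta$; and there is a reduction $\hat R$ such that $R^\alpha=\hat R$ for some $\alpha<\delta$ and, for every reduction $S$, $\hat R\xrightarrow{\ell}S$ only if $S=\hat R$. The range of the sequence is $\{R^\alpha:\alpha<\delta\}$; the range of a class of elimination sequences is the set of all reductions belonging to the range of some sequence in the class. Complete boundedness. A reduction $R$ is completely bounded if for all $i\in I$ and all $a_i\in R_i$: if $a_i\prec_{R_{-i}}b_i$ for some $b_i\in A_i$, then there is $c_i^*\in A_i$ such that $a_i\prec_{R_{-i}}c_i^*$ and there is no $c_i\in A_i$ with $c_i^*\prec_{R_{-i}}c_i$. A class of elimination sequences is completely bounded if every reduction in its range is completely bounded. *)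

(* Defs.v *)
From HB Require Import structures.
From mathcomp Require Import all_boot all_order all_algebra.
From mathcomp Require Import boolp classical_sets reals.
From mathcomp Require wochoice.

Set Implicit Arguments.
Unset Strict Implicit.
Unset Printing Implicit Defensive.

Local Open Scope classical_set_scope.
Local Open Scope ring_scope.

(* An ordinal is presented by a well-ordered type, whose points are the
   ordinals strictly below it; [wochoice.well_order] says that every non-empty
   subset has a unique minimum. *)
Record ord := Ord {
  ord_sort :> Type;
  ord_le : rel ord_sort;
  ord_wo : wochoice.well_order ord_le
}.

Section OrdinalPositions.
Variable d : ord.
Implicit Types a b c : d.

Definition ord_lt a b : Prop := ~~ ord_le b a.

Definition is_zero a : Prop := forall c, ord_le a c.

Definition is_succ a b : Prop :=
  ord_lt a b /\ forall c, ord_lt a c -> ord_le b c.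

Definition is_limit a : Prop := ~ is_zero a /\ forall b, ~ is_succ b a.

End OrdinalPositions.

Record oseq (T : Type) := OSeq {
  oseq_len : ord;
  oseq_val :> oseq_len -> T
}.

(* Decidable equality on the (arbitrary) set of players is no restriction in
   this classical setting; it is only used to override one coordinate of a
   strategy profile. *)
Record game (R : realType) := Game {
  player : eqType;
  strat : player -> Type;
  payoff : player -> (forall j, strat j) -> R;
  game_players : exists i j : player, i != j;
  game_strat : forall i, [set: strat i] !=set0
}.

Section Elimination.
Variables (R : realType) (G : game R).

Definition profile : Type := forall i : player G, strat i.
Definition factors : Type := forall i : player G, set (strat i).

Implicit Types (F : factors) (S T : set profile) (i : player G).

Definition box F : set profile := [set x | forall i, F i (x i)].

Definition reduction S : Prop := exists F, S = box F.

(* Opponents' profiles in the product of the F j, j != i, are represented by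
   full profiles whose i-th coordinate is irrelevant, being overridden in
   [sdom]. *)
Definition opp F i : set profile :=
  [set x | forall j, j != i -> F j (x j)].

(* [sdom F a b]: a is strictly dominated by b relative to the product of the
   F j, j != i. It is used only when [opp F i] is non-empty. *)
Definition sdom F i (a b : strat i) : Prop :=
  forall x, opp F i x -> payoff i (dfwith x a) < payoff i (dfwith x b).

Inductive elim_type := nested | universal.

Definition dominators (l : elim_type) F i : set (strat i) :=
  match l with nested => F i | universal => setT end.

(* The factors of a non-empty product are unique; those of the empty set are
   not, hence the existential quantifiers. When S is empty, dominance is
   undefined and only T `<=` S is required. *)
Definition reduces (l : elim_type) S T : Prop :=
  exists F F' : factors, [/\ S = box F, T = box F', T `<=` S &
    S !=set0 -> forall i (a : strat i), F i a -> ~ F' i a ->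
      exists b : strat i, dominators l F b /\ sdom F a b].

Definition terminal (l : elim_type) S : Prop :=
  forall T, reduction T -> reduces l S T -> T = S.

Record elimination_sequence (l : elim_type) (s : oseq (set profile)) : Prop := {
  elim_nonzero : [set: oseq_len s] !=set0;
  elim_reduction : forall a, reduction (s a);
  elim_zero : forall a, is_zero a -> s a = setT;
  elim_succ : forall a b, is_succ a b -> reduces l (s a) (s b);
  elim_limit : forall a, is_limit a ->
    s a = \bigcap_(b in [set b | ord_lt b a]) s b;
  elim_terminal : exists a, terminal l (s a)
}.

(* A class of sequences is a bare predicate rather than a [set], so that the
   universe of the well-ordered types is not bounded by that of [set]. *)
Definition seq_class : Type := oseq (set profile) -> Prop.

(* Sequences of length d are represented over every well-ordered type of order
   type d; being an elimination sequence is invariant under order isomorphism,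
   so equality of such classes is equality of the classes of ordinal-indexed
   sequences. *)
Definition elim_class (l : elim_type) : seq_class := elimination_sequence l.

Definition class_range (E : seq_class) : set (set profile) :=
  [set S | exists2 s, E s & exists a, s a = S].

Definition completely_bounded S : Prop :=
  forall F, S = box F -> S !=set0 ->
  forall i (a : strat i), F i a -> (exists b, sdom F a b) ->
  exists2 c' : strat i, sdom F a c' & ~ exists c, sdom F c' c.

Definition class_completely_bounded (E : seq_class) : Prop :=
  forall S, class_range E S -> completely_bounded S.

End Elimination.

Arguments elim_class {R} G l.

(* Main.v *)
(* Every elimination makes the surviving opponents' profiles fewer, so dominance
   persists along a sequence. Hence a strategy that is undominated relative to
   a stage has never been eliminated before it, and under complete boundedness
   every dominated strategy has an undominated, thus surviving, dominator:
   universal and nested reductions then agree at every stage, and so do their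
   terminal sets.
   Conversely, suppose that at a stage S some strategy [a] has dominators, all
   of them dominated. Either [a] has no surviving dominator, or one may, by a
   reduction which is also nested, eliminate all surviving dominators of [a]
   but one, [d], which then has dominators but no surviving one. Eliminating
   [a], resp. [d], is then universal but not nested. *)
Require Import Defs.
From mathcomp Require Import all_boot all_order all_algebra.
From mathcomp Require Import boolp classical_sets reals.
From mathcomp Require wochoice.

Set Implicit Arguments.
Unset Strict Implicit.
Unset Printing Implicit Defensive.

Import Order.TTheory.
Local Open Scope classical_set_scope.
Local Open Scope ring_scope.

(** * Well-ordered types and transfinite recursion *)

Section Ordinals.
Variable d : ord.
Implicit Types (a b c : d) (A : set d).

Lemma ord_min A : A !=set0 -> exists2 a, A a & forall b, A b -> ord_le a b.
Proof.
case=> x Ax.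
have [|z [[/asboolP Az zmin] _]] := @ord_wo d (fun y => `[< A y >]).
  by exists x; apply/asboolP.
by exists z => // b Ab; apply: zmin; apply/asboolP.
Qed.

Lemma ord_le_total a b : ord_le a b \/ ord_le b a.
Proof.
have [|z [->|->] zmin] := @ord_min [set a; b]; first by exists a; left.
  by left; apply: zmin; right.
by right; apply: zmin; left.
Qed.

Lemma ord_le_refl a : ord_le a a.
Proof. by case: (ord_le_total a a). Qed.

(** Both points are minima of the pair, and the minimum of a set is unique. *)
Lemma ord_le_anti a b : ord_le a b -> ord_le b a -> a = b.
Proof.
move=> ab ba; have [|z [_ zuniq]] := @ord_wo d (fun y => `[< y = a \/ y = b >]).
  by exists a; apply/asboolP; left.
rewrite -(zuniq a) ?(zuniq b) //; split; try by apply/asboolP; [left|right].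
  by apply/asboolP; right.
by move=> _ /asboolP[->|->] //; exact: ord_le_refl.
by apply/asboolP; left.
by move=> _ /asboolP[->|->] //; exact: ord_le_refl.
Qed.

Lemma ord_le_trans b a c : ord_le a b -> ord_le b c -> ord_le a c.
Proof.
move=> ab bc.
have [|z + zmin] := @ord_min [set y | [\/ y = a, y = b | y = c]].
  by exists a; constructor 1.
have za : ord_le z a by apply: zmin; constructor 1.
have zb : ord_le z b by apply: zmin; constructor 2.
have zc : ord_le z c by apply: zmin; constructor 3.
move=> [] ze; subst z => //; first by rewrite (ord_le_anti ab za).
by rewrite -(ord_le_anti bc zb).
Qed.

Lemma ord_ltW a b : ord_lt a b -> ord_le a b.
Proof. by move=> /negP nba; case: (ord_le_total a b). Qed.

Lemma ord_le_lt_trans b a c : ord_le a b -> ord_lt b c -> ord_lt a c.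
Proof. by move=> ab /negP bc; apply/negP => /ord_le_trans/(_ ab). Qed.

Lemma ord_lt_le_trans b a c : ord_lt a b -> ord_le b c -> ord_lt a c.
Proof. by move=> /negP ab bc; apply/negP => /(ord_le_trans bc). Qed.

Lemma ord_lt_irr a : ~ ord_lt a a.
Proof. by move/negP; apply; exact: ord_le_refl. Qed.

Lemma ord_leVlt a b : ord_le a b \/ ord_lt b a.
Proof. by rewrite /ord_lt; case: (ord_le a b); [left|right]. Qed.

Lemma ord_le_eqVlt a b : ord_le a b -> a = b \/ ord_lt a b.
Proof. by move=> ab; case: (ord_leVlt b a) => [/(ord_le_anti ab)|]; [left|right]. Qed.

Lemma ord_lt_ind (P : d -> Prop) :
  (forall a, (forall b, ord_lt b a -> P b) -> P a) -> forall a, P a.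
Proof.
move=> IH a; apply: contrapT => Pa.
have [|b Pb bmin] := @ord_min [set b | ~ P b]; first by exists a.
apply: Pb; apply: IH => c cb; apply: contrapT => /bmin bc.
exact: ord_lt_irr (ord_le_lt_trans bc cb).
Qed.

Lemma ord_lt_wf : well_founded (@ord_lt d).
Proof. by move=> a; elim/ord_lt_ind: a => a IH; constructor. Qed.

Lemma succ_exists a b : ord_lt a b -> exists2 c, is_succ a c & ord_le c b.
Proof.
move=> ab; have [|c ac cmin] := @ord_min [set c | ord_lt a c]; first by exists b.
by exists c; [split | apply: cmin].
Qed.

Lemma succ_le a b c : is_succ b c -> ord_lt a c -> ord_le a b.
Proof.
move=> [_ bc] ac; case: (ord_leVlt a b) => // /bc ca.
by case: (ord_lt_irr (ord_lt_le_trans ac ca)).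
Qed.

Lemma succ_inj a b c : is_succ a c -> is_succ b c -> a = b.
Proof.
by move=> ac bc; apply: ord_le_anti; [apply: succ_le bc ac.1|apply: succ_le ac bc.1].
Qed.

Lemma zero_succ_limit a :
  [\/ is_zero a, exists b, is_succ b a | is_limit a].
Proof.
have [|nz] := pselect (is_zero a); first by constructor 1.
have [|ns] := pselect (exists b, is_succ b a); first by constructor 2.
by constructor 3; split=> // b ba; apply: ns; exists b.
Qed.

(** Well-founded recursion, with the values on [D] prescribed. The last clause also covers a zero
    position outside [D], where the empty intersection is everything. *)
Lemma transfinite_iteration (T : Type) (D : set d) (s0 : d -> set T)
    (g : set T -> set T) :
  exists s : d -> set T,
    [/\ forall a, D a -> s a = s0 a,
        forall a b, ~ D b -> is_succ a b -> s b = g (s a)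
      & forall a, ~ D a -> (forall b, ~ is_succ b a) ->
          s a = \bigcap_(b in [set b | ord_lt b a]) s b].
Proof.
pose F a (rec : forall b, ord_lt b a -> set T) : set T :=
  if pselect (D a) then s0 a else
  match pselect (exists b, is_succ b a) with
  | left h => let v := cid h in g (rec (projT1 v) (projT2 v).1)
  | right _ => [set x | forall b (ba : ord_lt b a), rec b ba x]
  end.
have FE a : Fix ord_lt_wf _ F a = F a (fun b _ => Fix ord_lt_wf _ F b).
  apply: (Fix_eq ord_lt_wf (fun=> set T) F _ a) => x f1 f2 f12.
  suff -> : f1 = f2 by [].
  by do 2 apply: functional_extensionality_dep => ?.
exists (Fix ord_lt_wf _ F); split=> [a Da|a b nDb ab|a nDa ns];
  rewrite FE /F; case: pselect => //= _.
- case: pselect => [h|[]]; last by exists a.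
  by case: (cid h) => c cb /=; rewrite (succ_inj ab cb).
- case: pselect => [[b /ns]//|_].
  by apply/seteqP; split=> x /= h b; exact: h.
Qed.

End Ordinals.

(** * Well-orders too long for injective sequences *)

Lemma Cantor_set (U : Type) (f : set U -> U) : ~ injective f.
Proof.
move=> finj; pose D := [set u | exists2 A : set U, f A = u & ~ A u].
have nD : ~ D (f D) by move=> /[dup] DfD [A /finj ->]; apply.
by apply: (nD); exists D.
Qed.

(** The ordinal sum of [d] and a well-order of [set U]: [d] is an initial segment, and the tail is
    too long to be mapped injectively into [U]. *)
Lemma ord_extension (d : ord) (U : Type) :
  exists (e : ord) (i : d -> e) (j : set U -> e),
    [/\ forall a b, ord_le (i a) (i b) = ord_le a b,
        forall a x, ord_le x (i a) -> exists b, x = i b,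
        injective j
      & forall a A, ord_lt (i a) (j A)].
Proof.
have [r rwo] := wochoice.well_ordering_principle (set U).
pose d' := Ord rwo.
pose le (x y : d + d') := match x, y with
  | inl a, inl b => ord_le a b | inr a, inr b => ord_le a b
  | inl _, inr _ => true | inr _, inl _ => false end.
have lewo : wochoice.well_order le.
  apply: wochoice.antisymmetric_well_order => [[a|a] [b|b] //= /andP[ab ba]|A [x Ax]].
  - by rewrite (ord_le_anti ab ba).
  - by rewrite (@ord_le_anti d' _ _ ab ba).
  have [nel|el] := pselect ([set a | inl a \in A] !=set0).
    have [a Aa amin] := ord_min nel; exists (inl a); split=> // -[b|b] //.
    exact: amin.
  have [|a Aa amin] := @ord_min d' [set a | inr a \in A].
    by case: x Ax => [a Aa|a Aa]; [case: el; exists a|exists a].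
  exists (inr a); split=> // -[b Ab|b]; last exact: amin.
  by case: el; exists b.
exists (Ord lewo), inl, inr; split=> // [a [b _|//]|A B []//].
by exists b.
Qed.

(** * Reductions, their factors and dominance *)

Section Reductions.
Variables (R : realType) (G : game R).
Implicit Types (F : factors G) (S T : set (profile G)) (i j : player G)
  (l : elim_type).

(** A canonical choice of factors: the unique ones for a non-empty product, and all of them empty
    for the empty reduction. *)
Definition factor S : factors G := fun i => [set x i | x in S].

Arguments factor S i : clear implicits.

Definition dominated l S i (a : strat i) : Prop :=
  exists b, dominators l (factor S) b /\ sdom (factor S) a b.

(** [K] protects strategies from elimination. With [K] empty this is the maximal reduction of type
    [l], whose fixed points are terminal. *)
Definition prune l S (K : factors G) : set (profile G) :=
  box (fun i => [set a | factor S i a /\ (K i a \/ ~ dominated l S a)]).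

Lemma box_override F i x a : box F x -> F i a -> box F (dfwith x a).
Proof. by move=> Fx Fa j; case: dfwithP. Qed.

Lemma box_factor S : reduction S -> box (factor S) = S.
Proof.
move=> [F ->]; apply/seteqP; split=> x Fx i; last by exists x.
by have [y Fy <-] := Fx i.
Qed.

Lemma factor_box F : box F !=set0 -> factor (box F) = F.
Proof.
move=> [x Fx]; apply: functional_extensionality_dep => i.
apply/seteqP; split=> [_ [y Fy <-]|a Fa]; first exact: Fy.
by exists (dfwith x a); [exact: box_override|rewrite dfwith_in].
Qed.

Lemma factorS S T i : S `<=` T -> factor S i `<=` factor T i.
Proof. by move=> ST _ [x Sx <-]; exists x => //; apply: ST. Qed.

Lemma reduction_bigcap (I : Type) (D : set I) (s : I -> set (profile G)) :
  (forall b, D b -> reduction (s b)) -> reduction (\bigcap_(b in D) s b).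
Proof.
move=> sred; exists (fun i => \bigcap_(b in D) factor (s b) i).
apply/seteqP; split=> [x sx i b Db|x sx b Db]; first by exists x => //; apply: sx.
by rewrite -(box_factor (sred b Db)) => i; apply: sx.
Qed.

Lemma sdomS F F' i (a b : strat i) :
  (forall j, j != i -> F' j `<=` F j) -> sdom F a b -> sdom F' a b.
Proof. by move=> F'F ab x F'x; apply: ab => j ji; apply: F'F => //; apply: F'x. Qed.

Lemma sdom_factorS S T i (a b : strat i) :
  S `<=` T -> sdom (factor T) a b -> sdom (factor S) a b.
Proof. by move=> ST; apply: sdomS => j _; apply: factorS. Qed.

(** Non-emptiness supplies an opponents' profile; without one, dominance would hold vacuously. *)
Lemma sdom_irr S i (a : strat i) : S !=set0 -> ~ sdom (factor S) a a.
Proof.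
by move=> [x Sx] /(_ x); rewrite ltxx => h; have : false by apply: h => j _; exists x.
Qed.

Lemma sdom_trans F i (b a c : strat i) : sdom F a b -> sdom F b c -> sdom F a c.
Proof. by move=> ab bc x Fx; apply: lt_trans (ab x Fx) (bc x Fx). Qed.

Lemma dominatedW l S i (a : strat i) : dominated l S a -> dominated universal S a.
Proof. by move=> [b [_ ab]]; exists b. Qed.

Lemma dominated_universalS S T i (a : strat i) :
  S `<=` T -> dominated universal T a -> dominated universal S a.
Proof. by move=> ST [b [_ ab]]; exists b; split=> //; apply: sdom_factorS ab. Qed.

Lemma reduces_sub l S T : reduces l S T -> T `<=` S.
Proof. by case=> F [F' []]. Qed.

Lemma reduces_box l S F : reduction S -> box F `<=` S ->
  (S !=set0 -> forall i (a : strat i), factor S i a -> ~ F i a -> dominated l S a) ->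
  reduces l S (box F).
Proof. by move=> Sred FS Sdom; exists (factor S), F; rewrite box_factor. Qed.

(** Non-emptiness pins the factors of [S]. Those of [T] stay existential, because [T] may be
    empty. *)
Lemma reducesE l S T : reduces l S T -> S !=set0 ->
  exists2 F, T = box F &
    forall i (a : strat i), factor S i a -> ~ F i a -> dominated l S a.
Proof.
move=> [F [F' [-> -> _ h]]] S0; exists F' => // i a.
by rewrite /dominated factor_box//; apply: h.
Qed.

Lemma reduces_dominated l S T i (a : strat i) : reduces l S T -> T !=set0 ->
  factor S i a -> ~ factor T i a -> dominated l S a.
Proof.
move=> ST T0; have S0 : S !=set0 by case: T0 => x /(reduces_sub ST); exists x.
have [F TF h] := reducesE ST S0; rewrite TF in T0 *.
by rewrite factor_box//; apply: h.
Qed.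

Lemma reduces_universal l S T : reduces l S T -> reduces universal S T.
Proof.
move=> [F [F' [SF TF TS h]]]; exists F, F'; split=> // S0 i a Fa nF'a.
by have [b [_ ab]] := h S0 i a Fa nF'a; exists b.
Qed.

Lemma reduces_refl l S : reduction S -> reduces l S S.
Proof.
move=> Sred; rewrite -{2}(box_factor Sred); apply: reduces_box => //.
by rewrite box_factor.
Qed.

Lemma reduces_reduction l S T : reduces l S T -> reduction T.
Proof. by case=> F [F' [_ -> _ _]]; exists F'. Qed.

Lemma prune_sub l S K : reduction S -> prune l S K `<=` S.
Proof. by move=> Sred x Sx; rewrite -(box_factor Sred) => i; case: (Sx i). Qed.

Lemma reduces_prune l S K : reduction S -> reduces l S (prune l S K).
Proof.
move=> Sred; apply: reduces_box => //; first exact: prune_sub.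
by move=> _ i a Sa nPa; apply: contrapT => nda; apply: nPa; split=> //; right.
Qed.

Lemma prune_fixed l S K i (a : strat i) : prune l S K = S -> factor S i a ->
  K i a \/ ~ dominated l S a.
Proof. by move=> PS [x + <-]; rewrite -{1}PS => /(_ i)[]. Qed.

Lemma undominated_terminal l S : reduction S ->
  (forall i (a : strat i), factor S i a -> ~ dominated l S a) -> terminal l S.
Proof.
move=> Sred nd T _ ST; apply/seteqP; split; first exact: reduces_sub ST.
move=> x Sx; have [|F -> h] := reducesE ST; first by exists x.
move=> i; apply: contrapT => nFx; have Sxi : factor S i (x i) by exists x.
exact: nd Sxi (h _ _ Sxi nFx).
Qed.

(** Terminality is tested against the maximal reduction, which must therefore fix [S]. *)
Lemma terminal_undominated l S i (a : strat i) : reduction S -> terminal l S ->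
  factor S i a -> ~ dominated l S a.
Proof.
move=> Sred Sterm Sa.
have /Sterm PS : reduction (prune l S (fun=> set0)) by eexists.
by have [] := prune_fixed (PS (reduces_prune _ _ Sred)) Sa.
Qed.

(** * Stages, prefixes and completions of elimination sequences *)

(** The conditions are localised at one stage, so that prefixes can be treated before any terminal
    stage is known. *)
Definition valid_at l (s : oseq (set (profile G))) (a : oseq_len s) : Prop :=
  [/\ reduction (s a), is_zero a -> s a = setT,
      forall b, is_succ b a -> reduces l (s b) (s a)
    & is_limit a -> s a = \bigcap_(b in [set b | ord_lt b a]) s b].

Definition valid l (s : oseq (set (profile G))) (a : oseq_len s) : Prop :=
  forall b, ord_le b a -> valid_at l b.

(** Only a prefix ending in [S] is required; [reachable_range] completes it to an elimination
    sequence. *)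
Definition reachable l S : Prop :=
  exists (s : oseq (set (profile G))) (a : oseq_len s), valid l a /\ s a = S.

Lemma elimination_sequenceP l s : elimination_sequence l s <->
  (forall a : oseq_len s, valid_at l a) /\ exists a, terminal l (s a).
Proof.
split=> [[_ sred s0 ss sl st]|[sv [a st]]].
  by split=> // a; split=> //; [exact: s0|move=> b; exact: ss|exact: sl].
split; [by exists a| | | | |by exists a].
- by move=> b; case: (sv b).
- by move=> b; case: (sv b).
- by move=> b c; case: (sv c) => _ _ + _; apply.
- by move=> b; case: (sv b).
Qed.

Section Sequence.
Variables (l : elim_type) (s : oseq (set (profile G))).
Implicit Types a b c : oseq_len s.

Lemma valid_le a b : ord_le a b -> valid l b -> valid l a.
Proof. by move=> ab bv c ca; apply: bv; apply: ord_le_trans ab. Qed.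

Lemma valid_antitone a b c : valid l a -> ord_le b c -> ord_le c a ->
  s c `<=` s b.
Proof.
move=> av; elim/ord_lt_ind: c => c IH /ord_le_eqVlt[-> _ x //|bc ca].
have [cz|[e ec]|cl] := zero_succ_limit c.
- by case: (ord_lt_irr (ord_lt_le_trans bc (cz b))).
- have [_ _ /(_ e ec) /reduces_sub + _] := av c ca.
  move/subset_trans; apply; apply: IH; [exact: ec.1|exact: succ_le bc|].
  exact: ord_le_trans (ord_ltW ec.1) ca.
- by have [_ _ _ ->//] := av c ca; move=> x; apply.
Qed.

(** A profile can only be lost at a successor: stage zero contains every profile and limit stages
    are intersections. *)
Lemma valid_mem a x : valid l a ->
  (forall b c, ord_le c a -> is_succ b c -> s b x -> s c x) -> s a x.
Proof.
move=> av xsucc; suff : forall c, ord_le c a -> s c x by apply; exact: ord_le_refl.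
elim/ord_lt_ind => c IH ca; have [_ c0 cs cl] := av c ca.
have [/c0->//|[e ec]|/cl->] := zero_succ_limit c.
  by apply: xsucc (ec) _ => //; apply: IH ec.1 (ord_le_trans (ord_ltW ec.1) ca).
by move=> b bc; apply: IH bc (ord_le_trans (ord_ltW bc) ca).
Qed.

End Sequence.


(* The prefix of a sequence that reaches [S] is continued along a well-order of
   [set U], where [U] is the type of sets of profiles: by Cantor's theorem the
   stages cannot be pairwise distinct there, and a repetition is a fixed point
   of [g]. *)
Lemma iterate_reduction l (g : set (profile G) -> set (profile G)) S :
  (forall T, reduction T -> reduces l T (g T)) -> reachable l S ->
  exists (s : oseq (set (profile G))) (p q t : oseq_len s),
    [/\ forall a : oseq_len s, valid_at l a, s p = S,
        forall a b, ord_le p a -> is_succ a b -> s b = g (s a),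
        is_succ p q
      & ord_le p t /\ g (s t) = s t].
Proof.
move=> gred [s [a [av <-]]].
have [e [i [j [ile idown jinj ij]]]] := ord_extension (oseq_len s) (profile G -> Prop).
have ilt b c : ord_lt (i b) (i c) = ord_lt b c by rewrite /ord_lt ile.
have iinj : injective i.
  by move=> b c bc; apply: ord_le_anti; rewrite -ile bc; exact: ord_le_refl.
(* [D] is the copy of the given prefix; beyond it [g] takes over. [s0] transports the old values by
   a union over the fibres of [i]. *)
pose D := [set x | ord_le x (i a)].
pose s0 x := [set y | exists2 b, i b = x & s b y].
have s0i b : s0 (i b) = s b.
  by apply/seteqP; split=> [y [c /iinj->]//|y sy]; exists b.
have [v [vD vsucc vlim]] := transfinite_iteration D s0 g.
have vi b : ord_le b a -> v (i b) = s b.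
  by move=> ba; rewrite vD ?s0i// /D /= ile.
pose s' := OSeq v.
have valid' x : @valid_at l s' x.
  elim/ord_lt_ind: x => x IH.
  have [Dx|nDx] := pselect (D x).
    (* As [i] embeds an initial segment, zero, successor and limit positions in [D] correspond to
       those of the old prefix. *)
    have [b xb] := idown _ _ Dx; subst x.
    have ba : ord_le b a by rewrite -ile.
    have [bred bz bs bl] := av b ba.
    split=> /=; rewrite ?vi//.
    - by move=> zb; apply: bz => c; rewrite -ile; apply: zb.
    - move=> y yb; have [c yc] := idown _ _ (ord_ltW yb.1); subst y.
      have cb : is_succ c b.
        case: yb => cb bmin; split; first by rewrite -ilt.
        by move=> z; rewrite -ilt => /bmin; rewrite ile.
      by rewrite vi; [apply: bs|apply: ord_le_trans (ord_ltW cb.1) ba].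
    - move=> [nz ns]; rewrite bl; last first.
        split=> [bz'|c [cb bmin]].
          by apply: nz => y; have [/idown[c ->]|/ord_ltW//] := ord_leVlt y (i b);
            rewrite ile.
        apply: (ns (i c)); split; first by rewrite ilt.
        move=> y cy; have [/idown[z yz]|/ord_ltW//] := ord_leVlt y (i b); subst y.
        by rewrite ile; apply: bmin; rewrite -ilt.
      apply/seteqP; split=> [y sy x xb|y sy c cb].
        have [c xc] := idown _ _ (ord_ltW xb); subst x.
        have cb : ord_lt c b by rewrite -ilt.
        by rewrite vi; [apply: sy|apply: ord_le_trans (ord_ltW cb) ba].
      rewrite -vi; last by apply: ord_le_trans (ord_ltW cb) ba.
      by apply: sy; rewrite /= ilt.
  have [xz|[y yx]|[nz ns]] := zero_succ_limit x.
  - by case: nDx; apply: xz.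
  - have yred : reduction (v y) by have [] := IH _ yx.1.
    split=> /=; rewrite (vsucc _ _ nDx yx).
    + exact: reduces_reduction (gred _ yred).
    + by move=> /(_ y) xy; case: (ord_lt_irr (ord_lt_le_trans yx.1 xy)).
    + by move=> z zx; rewrite (succ_inj zx yx); apply: gred.
    + by move=> [_ /(_ y)].
  - split=> //= [|b /ns//|_]; last exact: vlim.
    by rewrite vlim//; apply: reduction_bigcap => b /IH[].
have vg x y : ord_le (i a) x -> is_succ x y -> v y = g (v x).
  move=> ax xy; apply: vsucc => // Dy.
  exact: ord_lt_irr (ord_lt_le_trans (ord_le_lt_trans ax xy.1) Dy).
have [q iaq _] := succ_exists (ij a set0).
have [[t [iat gt]]|nfix] := pselect (exists t, ord_le (i a) t /\ g (v t) = v t).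
  by exists s', (i a), q, t; split=> //=; rewrite vi//; exact: ord_le_refl.
have [] := @Cantor_set _ (v \o j).
suff vlt A B : ord_lt (j A) (j B) -> v (j A) <> v (j B).
  move=> A B /= vAB; apply: jinj.
  have [|/vlt] := ord_leVlt (j B) (j A); last by rewrite vAB.
  by move=> /ord_le_eqVlt[->//|/vlt]; rewrite vAB.
(* Stages decrease, so the stage at the successor [z] of [j A] is squeezed between the equal stages
   at [j A] and [j B]; hence [g] fixes the stage at [j A]. *)
move=> AB vAB; have [z Az zB] := succ_exists AB.
have zvalid : @valid l s' (j B) by move=> *; apply: valid'.
apply: nfix; exists (j A); split; first exact: ord_ltW.
rewrite -(vg (j A) z (ord_ltW (ij _ _)) Az); apply/seteqP; split.
  exact: (valid_antitone (s := s') (valid_le (s := s') zB zvalid) (ord_ltW Az.1) (ord_le_refl _)).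
by rewrite vAB; apply: (valid_antitone (s := s') zvalid zB (ord_le_refl _)).
Qed.

Lemma reachable_reduction l S : reachable l S -> reduction S.
Proof. by move=> [s [a [av <-]]]; have [] := av a (ord_le_refl a). Qed.

Lemma reachable_valid_at l (s : oseq (set (profile G))) (a : oseq_len s) :
  (forall b : oseq_len s, valid_at l b) -> reachable l (s a).
Proof. by move=> sv; exists s, a; split=> // b _; apply: sv. Qed.

(** Every proper reduction of a reachable [S] occurs as a step of a complete sequence, which is how
    a single step can separate the two classes. *)
Lemma step_in_sequence l S T : reachable l S -> reduces l S T -> T != S ->
  exists (s : oseq (set (profile G))) (p q : oseq_len s),
    [/\ elimination_sequence l s, is_succ p q, s p = S & s q = T].
Proof.
move=> Sreach ST TS.
(* A fixed point of [g] cannot be [S], since [T] differs from [S]; it is thus fixed by maximal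
   pruning, hence terminal. *)
pose g X := if X == S then T else prune l X (fun=> set0).
have gred X : reduction X -> reduces l X (g X).
  by rewrite /g; case: eqP => [->//|_]; apply: reduces_prune.
have [s [p [q [t [sv sp sg pq [_ gt]]]]]] := iterate_reduction gred Sreach.
exists s, p, q; split=> //; last by rewrite (sg p)// ?sp /g ?eqxx//; exact: ord_le_refl.
apply/elimination_sequenceP; split=> //; exists t.
have [tred _ _ _] := sv t; move: gt; rewrite /g; case: eqP => [-> /eqP|_ tfix].
  by rewrite (negbTE TS).
apply: undominated_terminal => // i a ta.
by have [] := prune_fixed tfix ta.
Qed.

Lemma reachable_range l S : reachable l S -> class_range (elim_class G l) S.
Proof.
move=> Sreach.
have gred X : reduction X -> reduces l X (prune l X (fun=> set0)).
  exact: reduces_prune.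
have [s [p [q [t [sv sp sg pq [_ tfix]]]]]] := iterate_reduction gred Sreach.
exists s; last by exists p.
apply/elimination_sequenceP; split=> //; exists t.
apply: undominated_terminal => [|i a ta]; first by have [] := sv t.
by have [] := prune_fixed tfix ta.
Qed.

Lemma reachable_step l S T : reachable l S -> reduces l S T -> reachable l T.
Proof.
move=> Sreach ST; have [->//|/eqP TS] := pselect (T = S).
have [s [p [q [/elimination_sequenceP[sv _] _ _ <-]]]] := step_in_sequence Sreach ST TS.
exact: reachable_valid_at.
Qed.


(** * From complete boundedness to equality of the classes *)

(** A dominator of [c] at an earlier stage would still dominate [c] at stage [a], where there are
    fewer opponents' profiles. *)
Lemma undominated_survives (s : oseq (set (profile G))) (a : oseq_len s) i
    (c : strat i) :
  valid universal a -> s a !=set0 -> ~ (exists b, sdom (factor (s a)) c b) ->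
  factor (s a) i c.
Proof.
move=> av [x sx] cund.
(* A profile is followed instead of the strategy: [x] with its [i]-th coordinate replaced by [c]. *)
suff sxc : s a (dfwith x c) by exists (dfwith x c); rewrite ?dfwith_in.
apply: (valid_mem av) => e b ba eb se.
have [_ _ /(_ e eb) red _] := av b ba.
have [|F sF Fdom] := reducesE red; first by eexists; exact: se.
have sab := valid_antitone av ba (ord_le_refl a).
rewrite sF; apply: box_override; first by rewrite -sF; apply: sab.
apply: contrapT => nFc.
have [|b' [_ cb']] := Fdom i c _ nFc; first by eexists; [exact: se|exact: dfwith_in].
apply: cund; exists b'; apply: sdom_factorS cb'.
exact: subset_trans sab (reduces_sub red).
Qed.

(** Boundedness gives an undominated dominator, and it survives in [S] by [undominated_survives]. *)
Lemma bounded_dominated_nested S i (a : strat i) :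
  reachable universal S -> completely_bounded S -> factor S i a ->
  dominated universal S a -> dominated nested S a.
Proof.
move=> Sreach Sbd Sa [b [_ ab]].
have S0 : S !=set0 by case: Sa => x Sx _; exists x.
have Sred := reachable_reduction Sreach.
have [|c ac cund] := Sbd _ (esym (box_factor Sred)) S0 i a Sa; first by exists b.
exists c; split=> //=; case: Sreach => s [e [ev se]]; subst S.
exact: undominated_survives.
Qed.

Lemma bounded_universal_nested S T :
  reachable universal S -> completely_bounded S ->
  reduces universal S T -> reduces nested S T.
Proof.
move=> Sreach Sbd ST; have Sred := reachable_reduction Sreach.
have [S0|nS] := pselect (S !=set0); last first.
  have [F TF] := reduces_reduction ST; rewrite TF; apply: reduces_box => //.
  by rewrite -TF; apply: reduces_sub ST.
have [F TF Fdom] := reducesE ST S0; rewrite TF; apply: reduces_box => //.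
  by rewrite -TF; apply: reduces_sub ST.
by move=> _ i a Sa nFa; apply: bounded_dominated_nested => //; apply: Fdom.
Qed.

Lemma valid_at_universal l (s : oseq (set (profile G))) (a : oseq_len s) :
  valid_at l a -> valid_at universal a.
Proof. by case=> sred s0 ss sl; split=> // b /ss/reduces_universal. Qed.

(** Keeping [l] arbitrary lets boundedness of either class yield the equality. *)
Lemma bounded_class_eq l : class_completely_bounded (elim_class G l) ->
  elim_class G nested = elim_class G universal.
Proof.
move=> lbd; have bd S : reachable l S -> completely_bounded S.
  by move/reachable_range/lbd.
apply: functional_extensionality_dep => s; apply: propext.
split=> /elimination_sequenceP[sv [t st]]; apply/elimination_sequenceP.
  have su (a : oseq_len s) : valid_at universal a by apply: valid_at_universal (sv a).
  have sl (a : oseq_len s) : valid_at l a by case: (l).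
  split=> //; exists t; have [tred _ _ _] := sv t.
  apply: undominated_terminal => // i a ta aund.
  have ureach := reachable_valid_at t su.
  have lbt := bd _ (reachable_valid_at t sl).
  exact: terminal_undominated st ta (bounded_dominated_nested ureach lbt ta aund).
(* Induction is needed when [l] is [nested]: boundedness of the stage [b] before [a] is available
   only once the prefix up to [b] is known to be nested. *)
have sn (a : oseq_len s) : valid_at nested a.
  elim/ord_lt_ind: a => a IH; case: (sv a) => ared az asucc alim; split=> // b ba.
  apply: bounded_universal_nested; [exact: reachable_valid_at| |exact: asucc].
  apply: bd; exists s, b; split=> // c cb.
  case: (l); last exact: sv.
  exact: IH (ord_le_lt_trans cb ba.1).
split=> //; exists t; have [tred _ _ _] := sv t.
apply: undominated_terminal => // i a ta /dominatedW.
exact: terminal_undominated st ta.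
Qed.

(** * From equality of the classes to complete boundedness *)

Definition remove S i (a : strat i) : set (profile G) :=
  box (dfwith (factor S) (factor S i `\ a)).

Lemma remove_sub S i (a : strat i) : reduction S -> remove S a `<=` S.
Proof.
move=> Sred x xS; rewrite -(box_factor Sred) => j.
by move: (xS j); move: (x j); case: dfwithP => // y [].
Qed.

Lemma reduces_remove l S i (a : strat i) : reduction S -> dominated l S a ->
  reduces l S (remove S a).
Proof.
move=> Sred da; apply: reduces_box => //; first exact: remove_sub.
move=> _ j; case: dfwithP => // b Sb nSb.
by have -> : b = a by apply: contrapT => ba; apply: nSb.
Qed.

(* If removing [a] empties [S], the empty set may still be a nested reduction
   through another player, all of whose strategies are dominated. Eliminating
   first every dominated strategy except those of a profile [d] through [a]
   rules this out. *)
Lemma escape_dominated S i (a : strat i) : reachable universal S ->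
  factor S i a -> dominated universal S a -> ~ dominated nested S a ->
  exists S' T, [/\ reachable universal S', reduces universal S' T
    & ~ reduces nested S' T].
Proof.
move=> Sreach Sa uda nda; have Sred := reachable_reduction Sreach.
have [rne|re] := pselect (remove S a !=set0).
  exists S, (remove S a); split=> //; first exact: reduces_remove.
  move=> /reduces_dominated/(_ rne Sa) da; apply/nda/da.
  by rewrite /remove factor_box// dfwith_in => -[_]; apply.
have [d Sd da] := Sa.
have Sonly b : factor S i b -> b = a.
  move=> Sb; apply: contrapT => ba; apply: re; exists (dfwith d b) => j.
  by case: dfwithP => [|k ik]; [rewrite dfwith_in|rewrite dfwith_out//; exists d].
pose K : factors G := fun j => [set d j].
have gred T : reduction T -> reduces universal T (prune nested T K).
  by move=> Tred; apply/reduces_universal/reduces_prune.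
have [s [p [q [t [sv sp sg pq [pt tfix]]]]]] := iterate_reduction gred Sreach.
have tv : valid universal t by move=> b _; apply: sv.
have ts := valid_antitone tv pt (ord_le_refl t); rewrite sp in ts.
(* Up to [p] the profile [d] is present because stages decrease; from [p] on it is protected by
   [K]. *)
have td : s t d.
  apply: (valid_mem tv) => b c ct bc bd; have [pb|bp] := ord_leVlt p b.
    by rewrite (sg _ _ pb bc) => j; split; [exists d|left].
  have pv : valid universal p by move=> e _; apply: sv.
  by apply: (valid_antitone pv (bc.2 _ bp) (ord_le_refl p)); rewrite sp.
have ta : factor (s t) i a by exists d.
exists (s t), set0; have tred : reduction (s t) by case: (sv t).
split; first exact: reachable_valid_at.
  have <- : remove (s t) a = set0.
    apply/seteqP; split=> // x /(_ i); rewrite dfwith_in => -[tx].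
    by apply; apply: Sonly; apply: factorS tx.
  by apply: reduces_remove => //; apply: dominated_universalS uda.
move=> /reducesE[|F F0 Fdom]; first by exists d.
(* An empty product has an empty factor, by choice; all strategies of that player [k] must then be
   dominated within the stage. *)
have [k Fk] : exists k, F k = set0.
  apply: contrapT => nF.
  have F1 k : exists y, F k y.
    apply: contrapT => nFk; apply: nF; exists k.
    by apply/seteqP; split=> // y Fy; apply: nFk; exists y.
  suff : set0 (fun k => projT1 (cid (F1 k))) by [].
  by rewrite F0 => k; case: (cid _).
have tdom y : factor (s t) k y -> dominated nested (s t) y.
  by move=> ty; apply: Fdom => //; rewrite Fk.
(* The dominator [y] of [d k] is itself dominated, so it survives pruning only by being [d k], which
   cannot dominate itself. *)
have [|y [ty dy]] := tdom (d k); first by exists d.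
have [yd|/(_ (tdom y ty))//] := prune_fixed tfix ty.
by rewrite yd in dy; apply: sdom_irr dy; exists d.
Qed.

(** [escape_dominated] applies either at [S] or, after the other surviving dominators of a witness
    [a] are eliminated, at [T] with [d] in place of [a]. *)
Lemma escape_unbounded S : reachable universal S -> ~ completely_bounded S ->
  exists S' T, [/\ reachable universal S', reduces universal S' T
    & ~ reduces nested S' T].
Proof.
move=> Sreach Sunb; have Sred := reachable_reduction Sreach.
have [[i [a [Sa [uda nda]]]]|nesc] := pselect (exists i (a : strat i),
    factor S i a /\ dominated universal S a /\ ~ dominated nested S a).
  exact: escape_dominated Sa uda nda.
have udn i (b : strat i) : factor S i b -> dominated universal S b -> dominated nested S b.
  by move=> Sb udb; apply: contrapT => ndb; apply: nesc; exists i, b.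
apply: contrapT => nesc'; apply: Sunb => F SF S0 i a Fa [b ab].
have FS : F = factor S by rewrite SF factor_box// -SF.
subst F; apply: contrapT => nc.
(* Failure of boundedness at [a] means that every dominator of [a] is dominated in turn. *)
have Dud c : sdom (factor S) a c -> dominated universal S c.
  move=> ac; apply: contrapT => cnd; apply: nc; exists c => // -[e ce].
  by apply: cnd; exists e.
have [d [/= Sd ad]] : dominated nested S a by apply: udn => //; exists b.
pose D := [set y | factor S i y /\ (sdom (factor S) a y -> y = d)].
pose T := box (dfwith (factor S) D).
have DS j : dfwith (factor S) D j `<=` factor S j.
  by case: dfwithP => [y []|k ik y].
have ST : reduces universal S T.
  apply: reduces_box => //.
    by move=> x Tx; rewrite -(box_factor Sred) => j; apply: DS.
  move=> _ j; case: dfwithP => // y Sy nDy.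
  by apply: Dud; apply: contrapT => nay; apply: nDy; split.
have Treach := reachable_step Sreach ST.
have T0 : T !=set0.
  have [x Sx _] := Sd; exists (dfwith x d) => j.
  by case: dfwithP => [|k ik]; [rewrite dfwith_in|rewrite dfwith_out//; exists x].
have FT : factor T = dfwith (factor S) D by apply: factor_box.
have Td : factor T i d by rewrite FT dfwith_in.
apply: nesc'; apply: (escape_dominated Treach Td).
  by apply: dominated_universalS (reduces_sub ST) (Dud _ ad).
(* A dominator [e] of [d] in [T] dominates [a] by transitivity, as the opponents' factors are
   unchanged. So [e] is [d], against irreflexivity. *)
move=> [e [/=]]; rewrite FT dfwith_in => -[Se ed] de.
have deS : sdom (factor S) d e.
  by apply: sdomS de => j ji; rewrite dfwith_out// eq_sym.
by apply: (sdom_irr S0 (a := d)); rewrite -{2}(ed (sdom_trans ad deS)).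
Qed.

(** The escaping step lies in a complete universal sequence; were the classes equal, that sequence
    would be nested and so would the step. *)
Lemma class_eq_bounded : elim_class G nested = elim_class G universal ->
  class_completely_bounded (elim_class G universal).
Proof.
move=> nu _ [s /elimination_sequenceP[sv _] [a <-]]; apply: contrapT.
move=> /(escape_unbounded (reachable_valid_at a sv))[S [T [Sreach ST nST]]].
have TS : T != S.
  apply/eqP => TS; apply: nST; rewrite TS.
  exact/reduces_refl/(reachable_reduction Sreach).
have [s' [p [q [s'u pq s'p s'q]]]] := step_in_sequence Sreach ST TS.
have : elim_class G nested s' by rewrite nu.
by move=> /elim_succ/(_ _ _ pq); rewrite s'p s'q.
Qed.

End Reductions.

Theorem theorem2 (R : realType) (G : game R) :
  (class_completely_bounded (elim_class G nested)
     <-> class_completely_bounded (elim_class G universal)) /\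
  (class_completely_bounded (elim_class G universal)
     <-> elim_class G nested = elim_class G universal).
Proof.
have nu := @bounded_class_eq R G; have un := @class_eq_bounded R G.
split; split=> bd.
- exact/un/nu/bd.
- by rewrite (nu _ bd).
- exact: nu bd.
- exact: un bd.
Qed.
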